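(* Let $n\ge 0$ be an integer. The variance of the statistic $JD$ (sum of jump distances) on the set of full binary trees with $n$ internal vertices, equipped with the uniform distribution, is $$ \frac{2 n \left(2 n^{2}-n -1\right)}{n^{3}+7 n^{2}+16 n +12}. $$
   Context: A full binary tree is an unlabeled ordered tree defined recursively: it is either the single-vertex tree, denoted $\cdot$, or a pair $T=[T_L,T_R]$ where $T_L$ (left subtree) and $T_R$ (right subtree) are full binary trees. The number of internal vertices $V(T)$ is defined by $V(\cdot)=0$, $V([T_L,T_R])=V(T_L)+V(T_R)+1$. The depth of the rightmost leaf $D(T)$ is defined by $D(\cdot)=0$, $D([T_L,T_R])=1+D(T_R)$. The sum of jump distances $JD(T)$ is defined by $JD(\cdot)=0$, $JD([T_L,T_R])=JD(T_L)+JD(T_R)+D(T_L)$. *)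

(* Defs.v *)
From HB Require Import structures.
From mathcomp Require Import all_boot all_order all_algebra.

Set Implicit Arguments.
Unset Strict Implicit.
Unset Printing Implicit Defensive.

Import GRing.Theory.

Inductive fbtree : Type := Leaf | Node (l r : fbtree).

Fixpoint V (t : fbtree) : nat :=
  if t is Node l r then V l + V r + 1 else 0.

Fixpoint D (t : fbtree) : nat :=
  if t is Node _ r then 1 + D r else 0.

Fixpoint JD (t : fbtree) : nat :=
  if t is Node l r then JD l + JD r + D l else 0.

Fixpoint fbtree_encode (t : fbtree) : GenTree.tree unit :=
  if t is Node l r
  then GenTree.Node 0 [:: fbtree_encode l; fbtree_encode r]
  else GenTree.Leaf tt.

Fixpoint fbtree_decode (g : GenTree.tree unit) : fbtree :=
  if g is GenTree.Node _ [:: l; r]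
  then Node (fbtree_decode l) (fbtree_decode r)
  else Leaf.

Lemma fbtree_encodeK : cancel fbtree_encode fbtree_decode.
Proof. by elim=> //= l -> r ->. Qed.

HB.instance Definition _ := Countable.copy fbtree (can_type fbtree_encodeK).

(* The trees of height at most [h]; used only to establish finiteness. *)
Fixpoint fbtrees_height (h : nat) : seq fbtree :=
  if h is h'.+1
  then Leaf :: [seq Node l r | l <- fbtrees_height h', r <- fbtrees_height h']
  else [:: Leaf].

Lemma mem_fbtrees_height h t : V t <= h -> t \in fbtrees_height h.
Proof.
elim: h t => [|h IHh] [|l r] //=; rewrite addn1 ?ltn0 // ltnS => le_h.
rewrite inE; apply/allpairsP; exists (l, r); split=> //=; apply: IHh.
  exact: leq_trans (leq_addr _ _) le_h.
exact: leq_trans (leq_addl _ _) le_h.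
Qed.

Record fbtree_of (n : nat) : Type :=
  FBTreeOf { fbtree_val :> fbtree; _ : V fbtree_val == n }.

HB.instance Definition _ n := [isSub for @fbtree_val n].
HB.instance Definition _ n := [Countable of fbtree_of n by <:].

Definition fbtree_of_enum n : seq (fbtree_of n) :=
  undup (pmap insub (fbtrees_height n)).

Lemma fbtree_of_enumP n : Finite.axiom (fbtree_of_enum n).
Proof.
apply: Finite.uniq_enumP; first exact: undup_uniq.
move=> t; rewrite mem_undup mem_pmap_sub; apply: mem_fbtrees_height.
by rewrite (eqP (valP t)).
Qed.

HB.instance Definition _ n := isFinite.Build (fbtree_of n) (@fbtree_of_enumP n).

Local Open Scope ring_scope.

(* Mean and variance under the uniform distribution on a nonempty finite type;
   both are 0 when the type is empty. *)
Definition mean (T : finType) (X : T -> rat) : rat :=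
  (\sum_(t : T) X t) / #|T|%:R.

Definition variance (T : finType) (X : T -> rat) : rat :=
  mean (fun t => (X t - mean X) ^+ 2).

(* Main.v *)
(** Every internal vertex lies on exactly one maximal right-going path, starting
    either at the root or at a left child; hence JD = V - D, and the variance of
    JD is that of D.  A tree with n + 1 internal vertices arises in a unique way
    from one with n by replacing a subtree S rooted on the rightmost path by
    [S, .]; a tree with D = d has d + 1 children, with D = 1, ..., d + 1.
    Summing 1 over the children and over the grandchildren expresses the first
    two moments of D through the Catalan numbers C(n), C(n+1) and C(n+2). *)
Require Import Defs.
From HB Require Import structures.
From mathcomp Require Import all_boot all_order all_algebra.
From mathcomp Require Import zify ring.

Import GRing.Theory.
Local Open Scope ring_scope.

Lemma JD_add_D t : (JD t + D t = V t)%N.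
Proof. by elim: t => //= l IHl r IHr; lia. Qed.

(** The grafts are listed from the root down the rightmost path, so [D] runs through 1, 2, ... in
    list order. *)
Fixpoint children (t : fbtree) : seq fbtree :=
  Node t Leaf :: (if t is Node l r then [seq Node l s | s <- children r] else [::]).

(** Undoes a graft: the lowest internal vertex of the rightmost path gives way to its left subtree.
    The value at [Leaf] is a mere default, whence the condition [s != Leaf] in [mem_children]. *)
Fixpoint parent (t : fbtree) : fbtree :=
  match t with
  | Leaf => Leaf
  | Node l Leaf => l
  | Node l r => Node l (parent r)
  end.

Lemma mem_children s t : (s \in children t) = (s != Leaf) && (parent s == t).
Proof.
elim: s t => [|l _ r IHr] t; first by case: t => [|l r]; rewrite ?inE //=; apply/mapP => -[].
have eqN a b c d : (Node a b == Node c d) = (a == c) && (b == d).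
  by apply/eqP/andP => [[-> ->]|[/eqP-> /eqP->]].
case: r IHr => [|rl rr] IHr.
  case: t => [|a b]; rewrite inE eqN eqxx andbT //=.
  (* The second disjunct is impossible: it would make [Leaf] a child of [b]. *)
  rewrite orb_idr // => /mapP[x]; rewrite -[x \in _]/(x \in children b).
  by case: b => [|? ?]; rewrite inE => xb [_ ex]; move: xb; rewrite -ex //=; case/mapP.
case: t => [|a b]; rewrite inE eqN andbF ?orbF //=.
transitivity ((l == a) && (Node rl rr \in children b)); last by rewrite IHr eqN.
apply/mapP/andP => [[x xb [-> ->]]|[/eqP-> ?]]; first by rewrite eqxx.
by exists (Node rl rr).
Qed.

Lemma children_uniq t : uniq (children t).
Proof.
elim: t => //= l _ r IHr; rewrite map_inj_uniq ?IHr ?andbT; last by move=> ? ? [].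
by apply/mapP => -[x]; rewrite mem_children => /andP[xL _] [_ /esym/eqP]; apply/negP.
Qed.

Lemma V_parent t : V (parent t) = (V t).-1.
Proof. by elim: t => // l _ [|rl rr] /=; [lia | move=> ->; lia]. Qed.

Lemma big_D_children (g : nat -> nat) t :
  (\sum_(s <- children t) g (D s) = \sum_(i < (D t).+1) g i.+1)%N.
Proof.
elim: t g => [|l _ r IHr] g; first by rewrite /= big_seq1 big_ord1.
by rewrite big_cons big_map big_ord_recl (IHr (g \o S)).
Qed.

Fixpoint trees (n : nat) : seq fbtree :=
  if n is m.+1 then [seq s | t <- trees m, s <- children t] else [:: Leaf].

Lemma mem_trees n t : (t \in trees n) = (V t == n).
Proof.
elim: n t => [|n IHn] t; first by case: t => [|l r] //=; rewrite inE addn1.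
apply/allpairsPdep/eqP => [[x [y [xn yx ->]]]|Vt].
  move: yx xn; rewrite mem_children IHn => /andP[yL /eqP<-]; rewrite V_parent.
  by case: y yL => //= l r _ /eqP; lia.
exists (parent t), t; rewrite IHn mem_children V_parent Vt !eqxx andbT.
by split=> //; apply: contra_eqN Vt => /eqP->.
Qed.

(** Different trees have disjoint lists of children, because [parent] recovers the tree from any
    child. *)
Lemma trees_uniq n : uniq (trees n).
Proof.
elim: n => //= n IHn; apply: allpairs_uniq_dep => //.
  by move=> t _; apply: children_uniq.
move=> _ _ /allpairsPdep[x [s [_ sx ->]]] /allpairsPdep[y [s' [_ sy ->]]] /= es.
move: sx sy; rewrite -es !mem_children => /andP[_ /eqP<-] /andP[_ /eqP<-].
by [].
Qed.

Lemma big_fbtree_of n (F : fbtree -> nat) :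
  (\sum_(t : fbtree_of n) F t = \sum_(t <- trees n) F t)%N.
Proof.
rewrite -(big_map (@fbtree_val n) xpredT F); apply: perm_big; apply: uniq_perm.
- by rewrite map_inj_uniq ?index_enum_uniq //; apply: val_inj.
- exact: trees_uniq.
move=> t; rewrite mem_trees; apply/mapP/eqP => [[x _ ->]|/eqP Vt].
  exact/eqP/(valP x).
by exists (FBTreeOf Vt) => //; rewrite mem_index_enum.
Qed.

(** The succession rule d -> 1, ..., d + 1 of the Catalan generating tree, as an operator on
    functions of [D]. *)
Definition sum_children (g : nat -> nat) (d : nat) : nat :=
  (\sum_(i < d.+1) g i.+1)%N.

Lemma sum_children0 g : sum_children g 0 = g 1%N.
Proof. exact: big_ord1. Qed.

Lemma sum_childrenS g d : sum_children g d.+1 = (sum_children g d + g d.+2)%N.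
Proof. exact: big_ord_recr. Qed.

Lemma sum_children1 d : sum_children (fun=> 1%N) d = d.+1.
Proof. by rewrite /sum_children sum1_card card_ord. Qed.

Lemma big_D_fbtree_ofS n (g : nat -> nat) :
  (\sum_(t : fbtree_of n.+1) g (D t) =
   \sum_(t : fbtree_of n) sum_children g (D t))%N.
Proof.
rewrite (big_fbtree_of _ (g \o D)) (big_fbtree_of _ (sum_children g \o D)).
rewrite /= big_allpairs_dep /=.
by apply: eq_bigr => t _; apply: big_D_children.
Qed.

(** Each level of the generating tree is traded for one application of the operator, until only the
    root [Leaf] is left, where [D] is 0. *)
Lemma big_D_fbtree_of n (g : nat -> nat) :
  (\sum_(t : fbtree_of n) g (D t) = iter n sum_children g 0)%N.
Proof.
elim: n g => [|n IHn] g; last by rewrite big_D_fbtree_ofS IHn -iterSr.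
by rewrite (big_fbtree_of _ (g \o D)) big_seq1.
Qed.

(* [iter n sum_children (fun=> 1) d] counts the forests of d + 1 trees with n
   internal vertices, so this is the ballot number formula. *)
Lemma iter_sum_children1 n d :
  (iter n sum_children (fun=> 1) d * n`! * (n + d).+1`! = d.+1 * (n.*2 + d)`!)%N.
Proof.
elim: n d => [|n IHn] d; first by rewrite /= mul1n mul1n factS.
elim: d => [|d IHd]; rewrite iterS.
  rewrite sum_children0; have /(congr1 (muln n.+1)) := IHn 1%N.
  rewrite doubleS !addn0 !addn1 !factS; move: (iter _ _ _ _) n`! (n.*2)`! => a x y.
  by rewrite -muln2 => E; lia.
(* Ballot recurrence a(n+1, d+1) = a(n+1, d) + a(n, d+2). The factors [n.+1] and [(n + d).+3] below
   bring both hypotheses to the common multiplier (n+1)! (n+d+3)!. *)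
rewrite sum_childrenS -iterS.
have := congr1 (muln n.+1) (IHn d.+2); have := congr1 (muln (n + d).+3) IHd.
move: (iter n.+1 _ _ d) (iter n _ _ d.+2) => a b.
rewrite doubleS !(addSn, addnS) !factS.
move: n`! ((n + d)`!)%N ((n.*2 + d)`!)%N => x y z; rewrite -muln2 => E1 E2; lia.
Qed.

Lemma card_fbtree_of_iter n : #|{: fbtree_of n}| = iter n sum_children (fun=> 1%N) 0%N.
Proof. by rewrite -big_D_fbtree_of sum1_card. Qed.

Lemma card_fbtree_ofS n :
  (n.+2 * #|{: fbtree_of n.+1}| = 2 * (2 * n).+1 * #|{: fbtree_of n}|)%N.
Proof.
rewrite !card_fbtree_of_iter.
have := iter_sum_children1 n.+1 0; have := iter_sum_children1 n 0.
move: (iter n.+1 _ _ _) (iter n _ _ _) => b a.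
rewrite !addn0 !mul1n doubleS !factS => <-.
have := fact_gt0 n; move: n`! => x x_gt0 /eqP; rewrite -muln2 => /eqP E.
(* The factor to cancel is the square of (n+1)!. *)
apply/eqP; rewrite -(eqn_pmul2r (_ : 0 < n.+1 * x * (n.+1 * x))%N) ?muln_gt0 ?x_gt0 //.
by apply/eqP; lia.
Qed.

Lemma card_fbtree_of_gt0 n : (0 < #|{: fbtree_of n}|)%N.
Proof.
elim: n => [|n IHn]; first by rewrite card_fbtree_of_iter.
by have := card_fbtree_ofS n; nia.
Qed.

Lemma sum_D_fbtree_of n :
  (#|{: fbtree_of n.+1}| = \sum_(t : fbtree_of n) D t + #|{: fbtree_of n}|)%N.
Proof.
rewrite -sum1_card (big_D_fbtree_ofS _ (fun=> 1%N)) -sum1_card -big_split /=.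
by apply: eq_bigr => t _; rewrite sum_children1 addn1.
Qed.

(** A tree with D = d has 2 + 3 + ... + (d+2) = (d+1)(d+4)/2 grandchildren, and (d+1)(d+4) = d^2 +
    5d + 4. *)
Lemma sum_D2_fbtree_of n :
  (2 * #|{: fbtree_of n.+2}| = \sum_(t : fbtree_of n) D t ^ 2 +
     5 * \sum_(t : fbtree_of n) D t + 4 * #|{: fbtree_of n}|)%N.
Proof.
rewrite -sum1_card (big_D_fbtree_ofS _ (fun=> 1%N)) (big_D_fbtree_ofS _ (sum_children _)).
rewrite -sum1_card !big_distrr -!big_split /=.
apply: eq_bigr => t _; elim: (D t) => [|d IHd].
  by rewrite sum_children0 sum_children1.
by rewrite sum_childrenS sum_children1 mulnDr IHd; lia.
Qed.

Lemma variance_mean (T : finType) (X : T -> rat) :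
  (0 < #|T|)%N -> variance X = mean (fun t => X t ^+ 2) - mean X ^+ 2.
Proof.
move=> T_gt0; have N0 : #|T|%:R != 0 :> rat by rewrite Num.Theory.pnatr_eq0 -lt0n.
rewrite {1}/variance {1}/mean.
under eq_bigr => t _ do rewrite sqrrB -mulr_natr -mulrA.
rewrite big_split sumrB -mulr_suml /= sumr_const -mulr_natr /mean.
by field.
Qed.

Lemma variance_reflect (T : finType) (c : rat) (X Y : T -> rat) :
  (0 < #|T|)%N -> (forall t, Y t = c - X t) -> variance Y = variance X.
Proof.
move=> T_gt0 YE; have N0 : #|T|%:R != 0 :> rat by rewrite Num.Theory.pnatr_eq0 -lt0n.
have meanY : mean Y = c - mean X.
  rewrite /mean; under eq_bigr => t _ do rewrite YE.
  by rewrite sumrB sumr_const -[c *+ _]mulr_natr; field.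
rewrite /variance meanY; congr (_ / _).
by apply: eq_bigr => t _; rewrite YE; ring.
Qed.

Lemma card_fbtree_ofS_rat n :
  #|{: fbtree_of n.+1}|%:R =
  2 * (2 * n%:R + 1) / (n%:R + 2) * #|{: fbtree_of n}|%:R :> rat.
Proof.
have n2 : n%:R + 2 != 0 :> rat by rewrite -natrD Num.Theory.pnatr_eq0 addn2.
apply: (mulfI n2); have := congr1 (fun k => k%:R : rat) (card_fbtree_ofS n).
by rewrite !natrM -[n.+2]addn2 -[(2 * n).+1]addn1 !natrD => ->; field.
Qed.

Theorem theorem8p2 (n : nat) :
  variance (fun t : fbtree_of n => (JD t)%:R) =
  2 * n%:R * (2 * n%:R ^+ 2 - n%:R - 1)
    / (n%:R ^+ 3 + 7 * n%:R ^+ 2 + 16 * n%:R + 12).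
Proof.
have N_gt0 := card_fbtree_of_gt0 n.
have JDE (t : fbtree_of n) : (JD t)%:R = n%:R - (D t)%:R :> rat.
  have /eqP := valP t; rewrite -JD_add_D => /(congr1 (fun k => k%:R : rat)) <-.
  by rewrite natrD addrK.
rewrite (variance_reflect _ _ _ _ N_gt0 JDE) variance_mean // /mean.
have sumD : \sum_(t : fbtree_of n) (D t)%:R =
    #|{: fbtree_of n.+1}|%:R - #|{: fbtree_of n}|%:R :> rat.
  by rewrite sum_D_fbtree_of natrD addrK natr_sum.
have sumD2 : \sum_(t : fbtree_of n) (D t)%:R ^+ 2 =
    2 * #|{: fbtree_of n.+2}|%:R - 5 * \sum_(t : fbtree_of n) (D t)%:R
      - 4 * #|{: fbtree_of n}|%:R :> rat.
  under eq_bigr => t _ do rewrite -natrX.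
  by rewrite -!natr_sum -!natrM sum_D2_fbtree_of !natrD; ring.
rewrite sumD2 sumD !card_fbtree_ofS_rat -[in n.+1%:R]addn1 natrD.
have : #|{: fbtree_of n}|%:R != 0 :> rat by rewrite Num.Theory.pnatr_eq0 -lt0n.
have n2 : n%:R + 2 != 0 :> rat by rewrite -natrD Num.Theory.pnatr_eq0 addn2.
have n3 : n%:R + 3 != 0 :> rat by rewrite -natrD Num.Theory.pnatr_eq0 addn3.
(* The factor n+2 comes from C(n+1)/C(n), squared in the square of the mean; n+3 comes from
   C(n+2)/C(n+1). *)
have -> : n%:R ^+ 3 + 7 * n%:R ^+ 2 + 16 * n%:R + 12 =
  (n%:R + 2) ^+ 2 * (n%:R + 3) :> rat by ring.
move: n%:R n2 n3 (_%:R) => x x2 x3 N N0.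
by field; rewrite x2 x3 N0.
Qed.
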